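(* Let $d\ge1$, let $X$ be a separable $F$-space, let $(T_a)_{a\in\mathbb R^d}$ be a strongly continuous operator group on $X$ which has the uniform mixing property, and let $(\lambda_n)$ be an increasing sequence of positive real numbers having property (SG). Then $\bigcap_{a\in\mathbb R^d\setminus\{0\}}HC(T_{\lambda_na})$ is a residual subset of $X$.
   Context: A separable $F$-space is a separable topological vector space carrying a complete translation-invariant metric. An operator group $(T_a)_{a\in\mathbb R^d}$ on $X$ is a family of continuous linear operators on $X$ with $T_0=I$ and $T_{a+b}=T_aT_b$; it is strongly continuous if $a\mapsto T_af$ is continuous for each $f\in X$. $HC(T_{\lambda_na})$ is the set of $x\in X$ such that $\{T_{\lambda_na}x:\ n\}$ is dense in $X$. $\|\cdot\|$ on $\mathbb R^d$ is the Euclidean norm. Uniform mixing property: for any nonempty open subsets $U,V$ of $X$ there exists $C>0$ such that, for any $p\ge 1$ and any $a_1,\dots,a_p\in\mathbb R^d$ with $\|a_i\|\ge C$ for all $i$ and $\|a_i-a_j\|\ge C$ for all $i\ne j$, there exists $f\in U$ such that $T_{a_j}f\in V$ for every $j=1,\dots,p$. Property (SG): an increasing sequence $(\lambda_n)$ has property (SG) if for any $B>0$ there exist $\rho>1$ and a subsequence $(\mu_n)$ of $(\lambda_n)$ such that $\mu_{n+1}\ge\rho\mu_n$ for all $n$ and, for any $n_0\in\mathbb N$, $\sum_{n=n_0+1}^{+\infty}\frac1{\mu_n}>\frac{B}{\mu_{n_0}}$. Residual means containing a dense $G_\delta$ subset. *)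

(* Defs.v *)
From mathcomp Require Import all_boot all_order all_algebra.
From mathcomp Require Import complex.
From mathcomp Require Import all_classical all_reals all_analysis.
From mathcomp Require Import borel_hierarchy.

Set Implicit Arguments.
Unset Strict Implicit.
Unset Printing Implicit Defensive.

Import Order.TTheory GRing.Theory Num.Theory.
Import numFieldNormedType.Exports.

Local Open Scope classical_set_scope.
Local Open Scope ring_scope.

Variant scalar_kind := RealScalars | ComplexScalars.

Definition scalars (R : realType) (k : scalar_kind) : numFieldType :=
  match k with
  | RealScalars => R
  | ComplexScalars => complex R
  end.

(* F-spaces are not assumed locally convex, which rules out [tvsType]; and
   [metricType] cannot be joined with [topologicalLmodType] after the fact, so
   the metric is a predicate on a topological vector space. The distance is
   R-valued even when the scalar field K is complex. *)
Record complete_invariant_metric (R : realType) (K : numFieldType)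
    (X : topologicalLmodType K) (dist : X -> X -> R) : Prop := {
  dist_refl : forall x, dist x x = 0 ;
  dist_positivity : forall x y, dist x y = 0 -> x = y ;
  dist_sym : forall x y, dist x y = dist y x ;
  dist_triangle : forall y x z, dist x z <= dist x y + dist y z ;
  dist_translation : forall x y z, dist (x + z) (y + z) = dist x y ;
  dist_nbhs : forall x : X,
    nbhs x = filter_from [set e : R | 0 < e] (fun e => [set y | dist x y < e]) ;
  dist_complete : forall u : nat -> X,
    (forall e, 0 < e -> exists N, forall m n, (N <= m)%N -> (N <= n)%N ->
      dist (u m) (u n) < e) ->
    exists x : X, u @ \oo --> x
}.

Definition F_space (R : realType) (K : numFieldType)
    (X : topologicalLmodType K) : Prop :=
  exists dist : X -> X -> R, complete_invariant_metric dist.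

Definition separable (X : topologicalType) : Prop :=
  exists D : set X, countable D /\ dense D.

Definition residual (X : topologicalType) (A : set X) : Prop :=
  exists G : set X, [/\ Gdelta G, dense G & G `<=` A].

(* The library norm on row vectors is the sup norm. *)
Definition enorm (R : realType) (d : nat) (a : 'rV[R]_d) : R :=
  Num.sqrt (\sum_(i < d) a 0 i ^+ 2).

Definition hypercyclic_vectors (X : topologicalType) (S : nat -> X -> X) :
    set X :=
  [set x | dense (range (fun n => S n x))].

Section OperatorGroup.
Context (R : realType) (K : numFieldType) (X : topologicalLmodType K) (d : nat).

Record operator_group (T : 'rV[R]_d -> {linear X -> X}) : Prop := {
  opgroup_continuous : forall a, continuous (T a) ;
  opgroup0 : forall f, T 0 f = f ;
  opgroupD : forall a b f, T (a + b) f = T a (T b f)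
}.

Definition strongly_continuous (T : 'rV[R]_d -> {linear X -> X}) : Prop :=
  forall f : X, continuous (fun a => T a f).

Definition uniform_mixing (T : 'rV[R]_d -> {linear X -> X}) : Prop :=
  forall U V : set X, open U -> U !=set0 -> open V -> V !=set0 ->
    exists2 C : R, 0 < C &
      forall (p : nat) (a : 'I_p -> 'rV[R]_d), (1 <= p)%N ->
        (forall i, C <= enorm (a i)) ->
        (forall i j, i != j -> C <= enorm (a i - a j)) ->
        exists2 f : X, U f & forall j, V (T (a j) f).

End OperatorGroup.

Definition property_SG (R : realType) (lambda : R^nat) : Prop :=
  forall B : R, 0 < B ->
    exists (rho : R) (phi : nat -> nat),
      let mu := lambda \o phi in
      [/\ 1 < rho,
          increasing_seq phi,
          forall n, rho * mu n <= mu n.+1 &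
          forall n0, ((B / mu n0)%:E <
            \sum_(n0.+1 <= n <oo) ((mu n)^-1)%:E)%E].

(* Main.v *)
Require Import Defs.
From mathcomp Require Import all_boot all_order all_algebra.
From mathcomp Require Import all_classical all_reals all_analysis.
From mathcomp Require Import zify ring lra.

Set Implicit Arguments.
Unset Strict Implicit.
Unset Printing Implicit Defensive.

Import Order.TTheory GRing.Theory Num.Theory.
Import numFieldNormedType.Exports.

Local Open Scope classical_set_scope.
Local Open Scope ring_scope.


(** Write |.| for the sup norm. For an annulus A and an open V, the set of f
    such that every a in A admits an n with T_(lambda_n a) f in V is open, by
    compactness of A and joint continuity of (a, f) |-> T_a f (a Baire argument
    turns strong continuity into local equicontinuity). Countably many of these
    sets intersect in the common hypercyclic vectors, so it remains to prove
    that each is dense. By uniform mixing and local equicontinuity, this reduces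
    to finding finitely many C-separated points p, of norm at least C, such that
    every a in A has some lambda_n a within delta of some p.

    Property (SG) with B = 2M forces the terms mu_n, ..., mu_(n+M) to lie
    within a factor 2 of each other for arbitrarily large n, since otherwise the
    tails of the series of 1 / mu_k would be dominated by a geometric series. A
    small cube is tiled by a grid of step h ~ delta / mu_n whose nodes are sorted
    into M = (L+1)^d classes modulo L+1; the i-th class is scaled by mu_(n+i).
    Nodes in the same class are C / mu_n apart; nodes in different classes are
    sent far apart because mu_(k+1) >= rho mu_k and the cube, whose size depends
    on rho, is small compared to its distance to 0. The finitely many small cubes
    covering A are treated one after the other, with larger and larger n. *)

(** * Baire's theorem and joint continuity of the group on an F-space *)

Section FSpace.
Context (R : realType) (K : numFieldType) (X : topologicalLmodType K).
Context (dist : X -> X -> R) (distP : complete_invariant_metric dist).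

Lemma nbhs_distP x (A : set X) :
  nbhs x A <-> exists2 e, 0 < e & forall y, dist x y < e -> A y.
Proof. by rewrite (dist_nbhs distP); split=> -[e e0 eA]; exists e. Qed.

Lemma open_dist x e : open [set y | dist x y < e].
Proof.
rewrite openE => y /= xye; apply/nbhs_distP.
exists (e - dist x y) => [|z yz]; first by rewrite subr_gt0.
by have /= := dist_triangle distP y x z; lra.
Qed.

Lemma distDr x y z : dist (x + y) (x + z) = dist y z.
Proof. by rewrite !(addrC x) (dist_translation distP). Qed.

Lemma dist0B x y : dist 0 (y - x) = dist x y.
Proof. by rewrite -(distDr x) addr0 addrC subrK. Qed.

(** Nested closed balls: ball n+1 lies in ball n and in [F n], with radius below 1/(n+1). The
    centres are Cauchy and their limit lies in every ball. *)
Lemma F_space_Baire (F : (set X)^nat) :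
  (forall i, open (F i)) -> (forall i, dense (F i)) -> dense (\bigcap_i F i).
Proof.
move=> oF dF O [x0 Ox0] oO.
have [r0 r00 r0O] : exists2 r : R, 0 < r & forall y, dist x0 y <= r -> O y.
  have /nbhs_distP[e e0 eO] := open_nbhs_nbhs (conj oO Ox0).
  by exists (e / 2) => [|y y2]; [lra | apply: eO; lra].
(* The condition on the radius lets [choice] produce a total function; positivity of the radii is
   then recovered by induction. *)
pose good (p : nat * (X * R)) (q : X * R) := 0 < p.2.2 ->
  [/\ 0 < q.2, q.2 < p.1.+1%:R^-1 &
    forall y, dist q.1 y <= q.2 -> dist p.2.1 y <= p.2.2 /\ F p.1 y].
have step p : exists q : X * R, good p q.
  case: p => n [x r].
  have [r_gt0|r_le0] := ltP 0 r; last first.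
    by exists (x, r); rewrite /good/= => r_gt0; lra.
  have [y [/= xy Fy]] : [set y | dist x y < r] `&` F n !=set0.
    by apply: dF; [exists x; rewrite /= (dist_refl distP) | exact: open_dist].
  have /nbhs_distP[e e0 eF] := open_nbhs_nbhs (conj (oF n) Fy).
  pose s := Num.min (e / 2) (Num.min ((r - dist x y) / 2) (n.+2%:R^-1)).
  have n20 : (0 : R) < n.+2%:R^-1 by rewrite invr_gt0.
  have n2 : (n.+2%:R^-1 : R) < n.+1%:R^-1.
    by rewrite ltf_pV2 ?posrE// ltr_nat.
  have s0 : 0 < s by rewrite !lt_min n20 !divr_gt0//= subr_gt0.
  have se : s <= e / 2 by rewrite /s ge_min lexx.
  have sr : s <= (r - dist x y) / 2 by rewrite /s !ge_min lexx orbT.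
  have sn : s <= n.+2%:R^-1 by rewrite /s !ge_min lexx !orbT.
  exists (y, s) => _ /=; split=> [//||z yz]; first exact: le_lt_trans n2.
  split; last by apply: eF; lra.
  by have := dist_triangle distP y x z; lra.
have [f fP] := choice step.
pose fix p n := if n is m.+1 then f (m, p m) else (x0, r0).
have p0 n : 0 < (p n).2.
  by elim: n => [//|n IHn]; have [] := fP (n, p n) IHn.
have pS n : (p n.+1).2 < n.+1%:R^-1 by have [] := fP (n, p n) (p0 n).
have sub m n y : (m <= n)%N -> dist (p n).1 y <= (p n).2 ->
    dist (p m).1 y <= (p m).2.
  elim: n => [|n IHn]; first by rewrite leqn0 => /eqP->.
  rewrite leq_eqVlt => /predU1P[->//|mn] ny; apply: IHn => //.
  by have [_ _ /(_ y ny)[]] := fP (n, p n) (p0 n).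
have near_p m n : (m <= n)%N -> dist (p m).1 (p n).1 <= (p m).2.
  by move=> mn; apply: (sub _ _ _ mn); rewrite (dist_refl distP) ltW.
have [l lP] : exists l : X, (fun n => (p n).1) @ \oo --> l.
  apply: (dist_complete distP) => e e0.
  have [N Ne] : exists N : nat, (N.+1%:R^-1 : R) < e / 2.
    exists (Num.truncn (e / 2)^-1).
    by rewrite -ltf_pV2 ?posrE ?invr_gt0 ?divr_gt0// invrK truncnS_gt.
  exists N.+1 => m n Nm Nn.
  have := near_p _ _ Nm; have := near_p _ _ Nn.
  have := dist_triangle distP (p N.+1).1 (p m).1 (p n).1.
  rewrite (dist_sym distP (p m).1 (p N.+1).1).
  by move: (p N.+1).2 (lt_trans (pS N) Ne) => t *; lra.
have lp n : dist (p n).1 l <= (p n).2.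
  apply/ler_addgt0Pr => e e0.
  have /lP[N _ Ne] : nbhs l [set y | dist l y < e].
    by apply/nbhs_distP; exists e.
  have := Ne _ (leq_maxl N n); have := near_p _ _ (leq_maxr N n).
  have := dist_triangle distP (p (maxn N n)).1 (p n).1 l => /=.
  by rewrite (dist_sym distP l); lra.
exists l; split=> [|i _]; first by apply: r0O; have := lp 0%N.
by have [_ _ /(_ l (lp i.+1))[]] := fP (i, p i) (p0 i).
Qed.

Context (d : nat) (T : 'rV[R]_d -> {linear X -> X}).
Context (groupT : operator_group T) (contT : strongly_continuous T).

Lemma strongly_continuous_at0 f e : 0 < e ->
  exists2 delta, 0 < delta & forall b, `|b| < delta -> dist f (T b f) < e.
Proof.
move=> e0.
have /(@contT f 0)/nbhs_normP[delta delta0 deltaP] :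
    nbhs (T 0 f) [set y | dist f y < e].
  by rewrite (opgroup0 groupT); apply/nbhs_distP; exists e.
by exists delta => // b bd; apply: deltaP; rewrite /= sub0r normrN.
Qed.

(** By Baire, some closed set [E m] has an interior point f0, and linearity moves the uniform
    estimate around f0 to 0. *)
Lemma operator_group_equicontinuous0 e : 0 < e ->
  exists delta r, [/\ 0 < delta, 0 < r &
    forall b g, `|b| < delta -> dist 0 g < r -> dist 0 (T b g) < e].
Proof.
move=> e0.
pose E m := [set f | forall b : 'rV[R]_d,
  `|b| < m.+1%:R^-1 -> dist f (T b f) <= e / 4].
have oE m : open (~` E m).
  rewrite openE => f /existsNP[b] /not_implyP[bm] /negP.
  rewrite -ltNge => fb.
  pose t := (dist f (T b f) - e / 4) / 2.
  have t0 : 0 < t by rewrite divr_gt0// subr_gt0.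
  have /(opgroup_continuous groupT)/nbhs_distP[s s0 sP] :
    nbhs (T b f) [set y | dist (T b f) y < t] by apply/nbhs_distP; exists t.
  apply/nbhs_distP; exists (Num.min s t) => [|g]; first by rewrite lt_min s0.
  rewrite lt_min => /andP[/sP /= Tfg fg] /(_ b bm).
  have := dist_triangle distP g f (T b f).
  have := dist_triangle distP (T b g) g (T b f).
  by rewrite (dist_sym distP (T b g)) /t in Tfg fg *; lra.
(* Were all complements dense, some f would lie outside every [E m], against strong continuity at
   0. *)
have [m /denseNE[W [[f0 [oW Wf0]] WE]]] : exists m, ~ dense (~` E m).
  apply/existsNP => dE.
  have [f [_ fE]] := F_space_Baire oE dE (ex_intro _ 0 I) openT.
  have [delta delta0 fd] := @strongly_continuous_at0 f (e / 4) ltac:(lra).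
  apply: (fE (Num.truncn delta^-1) I) => b bd; apply/ltW/fd/(lt_trans bd).
  by rewrite -ltf_pV2 ?posrE ?invr_gt0// invrK truncnS_gt.
have {}WE f : W f -> E m f.
  by move=> Wf; apply: contrapT => nEf; have : set0 f by rewrite -WE.
have /nbhs_distP[r r0 rW] := open_nbhs_nbhs (conj oW Wf0).
exists m.+1%:R^-1, (Num.min r (e / 4)); split=> [||b g bm].
- by rewrite invr_gt0.
- by rewrite lt_min r0/=; lra.
- rewrite lt_min => /andP[gr ge].
  have f0g : dist f0 (f0 + g) = dist 0 g.
    by rewrite -[X in dist X _]addr0 distDr.
  have Eg : dist (f0 + g) (T b (f0 + g)) <= e / 4.
    by apply: WE => //; apply: rW; rewrite f0g.
  have E0 : dist f0 (T b f0) <= e / 4 by apply: WE.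
  (* Each of the three moves from T_b f0 to f0, to f0 + g, to T_b (f0 + g) costs at most e/4. *)
  have -> : dist 0 (T b g) = dist (T b f0) (T b (f0 + g)).
    by rewrite raddfD -(dist0B (T b f0)) addrAC subrr add0r.
  have := dist_triangle distP f0 (T b f0) (T b (f0 + g)).
  have := dist_triangle distP (f0 + g) f0 (T b (f0 + g)).
  by rewrite (dist_sym distP (T b f0) f0) f0g; lra.
Qed.

(** Since T_b g = T_a (T_(b-a) g), continuity of T_a reduces the claim to small indices b - a, where
    strong continuity handles f and equicontinuity handles g - f. *)
Lemma operator_group_continuous a f (V : set X) : nbhs (T a f) V ->
  exists delta r, [/\ 0 < delta, 0 < r &
    forall b g, `|b - a| < delta -> dist f g < r -> V (T b g)].
Proof.
move=> /(opgroup_continuous groupT)/nbhs_distP[e e0 eV].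
have [d1 [r [d10 r0 Tr]]] := @operator_group_equicontinuous0 (e / 2) ltac:(lra).
have [d2 d20 Td] := @strongly_continuous_at0 f (e / 2) ltac:(lra).
exists (Num.min d1 d2), r; split=> [|//|b g]; first by rewrite lt_min d10.
rewrite lt_min => /andP[b1 b2] fg.
have := Td _ b2; have := Tr _ (g - f) b1; rewrite dist0B => /(_ fg).
rewrite raddfB dist0B => h1 h2.
rewrite -(subrK a b) addrC (opgroupD groupT); apply: eV.
by have := dist_triangle distP (T (b - a) f) f (T (b - a) g); lra.
Qed.

End FSpace.

(** * Sup norm and grids *)

Section Covering.
Context (R : realType) (d : nat).
Implicit Types (a c p : 'rV[R]_d) (h : R).

Lemma rV_coord_le a i : `|a 0 i| <= `|a|.
Proof.
rewrite [leRHS]/Num.norm/= mx_normrE.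
by apply/bigmax_geP; right; exists (0, i).
Qed.

Lemma rV_norm_le a t : 0 <= t -> (forall i, `|a 0 i| <= t) -> `|a| <= t.
Proof.
move=> t0 at_; rewrite [leLHS]/Num.norm/= mx_normrE.
by apply/bigmax_leP; split=> // -[i j] _; rewrite ord1.
Qed.

Lemma rV_norm_coord a : 0 < `|a| -> exists i, `|a| = `|a 0 i|.
Proof.
move=> /lt0r_neq0/mx_norm_neq0[[i j] aij].
by exists j; rewrite -(ord1 i).
Qed.

Lemma rV_norm_le_enorm a : `|a| <= enorm a.
Proof.
apply: rV_norm_le => [|i]; first exact: sqrtr_ge0.
rewrite -sqrtr_sqr ler_wsqrtr// (bigD1 i)//= lerDl.
by apply: sumr_ge0 => j _; exact: sqr_ge0.
Qed.

(* The factor [w i - N] ranges over the integers of [-N, N]. *)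
Definition grid h N (w : {ffun 'I_d -> 'I_N.*2.+1}) : 'rV[R]_d :=
  \row_i (h * ((w i)%:R - N%:R)).

Lemma grid_approx h N a : 0 < h -> `|a| <= h * N%:R ->
  exists w, `|a - @grid h N w| <= h.
Proof.
move=> h0 aN.
have coord i : exists k : 'I_N.*2.+1, `|a 0 i - h * (k%:R - N%:R)| <= h.
  have := le_trans (rV_coord_le a i) aN; rewrite ler_norml => /andP[aN1 aN2].
  (* The shift by N puts x in [0, 2N], so truncation gives a valid index. *)
  pose x := a 0 i / h + N%:R.
  have ax : a 0 i = h * (x - N%:R) by rewrite /x addrK mulrC divfK ?gt_eqF.
  have x0 : 0 <= x by rewrite /x -lerBlDr sub0r ler_pdivlMr// mulNr mulrC.
  have xN : x < N.*2.+1%:R.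
    rewrite (@le_lt_trans _ _ N.*2%:R) ?ltr_nat// -addnn natrD lerD2r.
    by rewrite ler_pdivrMr// mulrC.
  have /andP[kx xk] := truncn_itv x0.
  have kN : (Num.truncn x < N.*2.+1)%N by rewrite -(ltr_nat R) (le_lt_trans kx).
  exists (Ordinal kN).
  rewrite ax -mulrBr /= opprB addrA subrK normrM gtr0_norm//.
  rewrite ger_pMr// ger0_norm ?subr_ge0// lerBlDr.
  by move: xk; rewrite -natr1 addrC => /ltW.
have [k kP] := choice coord.
exists [ffun i => k i]; apply: rV_norm_le => [|i]; first exact: ltW.
by rewrite !mxE ffunE; exact: kP.
Qed.

(** * Lacunary sequences and windows of comparable terms *)

Section Lacunary.
Context (mu : R^nat) (rho : R).
Context (rho1 : 1 < rho) (mu0 : forall n, 0 < mu n).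
Context (muS : forall n, rho * mu n <= mu n.+1).

Lemma lacunary_lt m n : (m < n)%N -> rho * mu m <= mu n.
Proof.
elim: n => [//|n IHn]; rewrite ltnS leq_eqVlt => /predU1P[->//|/IHn mn].
by apply: le_trans mn (le_trans _ (muS n)); rewrite ler_peMl ?ltW.
Qed.

Lemma lacunary_le m n : (m <= n)%N -> mu m <= mu n.
Proof.
rewrite leq_eqVlt => /predU1P[->//|/lacunary_lt].
by apply: le_trans; rewrite ler_peMl ?ltW.
Qed.

Lemma lacunary_unbounded Z : exists N, forall n, (N <= n)%N -> Z <= mu n.
Proof.
have lin n : mu 0%N * (1 + n%:R * (rho - 1)) <= mu n.
  elim: n => [|n IHn]; first by rewrite mul0r addr0 mulr1.
  have : 0 <= (rho - 1) * (mu n - mu 0).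
    by rewrite mulr_ge0 ?subr_ge0 ?lacunary_le// ltW.
  by have := muS n; rewrite -natr1; lra.
pose y := mu 0%N * (rho - 1).
have y0 : 0 < y by rewrite mulr_gt0 ?subr_gt0.
exists (Num.truncn (Z / y)).+1 => n Nn.
have : Z / y < n%:R by rewrite (lt_le_trans (truncnS_gt _))// ler_nat.
rewrite ltr_pdivrMr// => Zn; apply: le_trans (lin n); rewrite mulrDr mulr1.
by rewrite mulrCA; have := mu0 0; rewrite -/y; lra.
Qed.

(** Otherwise mu eventually doubles every M steps, and summing the inverses in blocks of M gives at
    most (M / mu_n)(1 + 1/2 + 1/4 + ...) = 2M / mu_n, against the strict lower bound. *)
Lemma lacunary_window M :
  (0 < M)%N ->
  (forall n0,
    ((M.*2%:R / mu n0)%:E < \sum_(n0.+1 <= n <oo) ((mu n)^-1)%:E)%E) ->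
  forall Z, exists n, Z <= mu n /\ mu (n + M) <= 2 * mu n.
Proof.
move=> M0 SG Z; have [N NZ] := lacunary_unbounded Z.
apply: contrapT => /forallNP noM.
have double n : (N <= n)%N -> 2 * mu n <= mu (n + M).
  move=> Nn; rewrite leNgt; apply/negP => lt2.
  by apply: (noM n); split; [exact: NZ | exact: ltW].
have inv_le m n : (m <= n)%N -> (mu n)^-1 <= (mu m)^-1.
  by move=> mn; rewrite lef_pV2 ?posrE//; exact: lacunary_le.
have short n k : \sum_(n.+1 <= i < n.+1 + k) (mu i)^-1 <= k%:R / mu n.
  apply: (@le_trans _ _ (\sum_(n.+1 <= i < n.+1 + k) (mu n)^-1)).
    by apply: ler_sum_nat => i /andP[ni _]; exact/inv_le/ltnW.
  by rewrite big_const_nat addKn iter_addr_0 mulr_natl.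
(* Induction peels off one block: M / mu_n + 2M / mu_(n+M) <= 2M / mu_n. *)
have long k n : (N <= n)%N ->
    \sum_(n.+1 <= i < n.+1 + k) (mu i)^-1 <= M.*2%:R / mu n.
  elim/ltn_ind: k n => k IHk n Nn; have [kM|Mk] := leqP k M.
    apply: le_trans (short n k) _; rewrite ler_wpM2r ?invr_ge0 ?(ltW (mu0 n))//.
    by rewrite ler_nat; lia.
  rewrite (big_cat_nat (n := (n.+1 + M)%N)) ?leq_addr ?leq_add2l 1?ltnW//=.
  have -> : (n.+1 + k = (n + M).+1 + (k - M))%N by lia.
  have := IHk (k - M)%N ltac:(lia) (n + M)%N (leq_trans Nn (leq_addr _ _)).
  have := short n M; rewrite addSn.
  have : (mu (n + M))^-1 <= (mu n)^-1 / 2.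
    by rewrite -invfM lef_pV2 ?posrE ?mulr_gt0// mulrC double.
  rewrite -addnn natrD; have : (0 : R) <= M%:R by [].
  move: (M%:R) (mu (n + M))^-1 (mu n)^-1 => x y z *; nra.
have := SG N; rewrite ltNge => /negP; apply.
apply: lime_le.
  by apply: is_cvg_nneseries => n _ _; rewrite lee_fin invr_ge0 ltW.
apply: nearW => n; rewrite sumEFin lee_fin.
have [nN|Nn] := leqP n N.+1.
  by rewrite big_geq// divr_ge0// ltW.
by rewrite -(subnKC (ltnW Nn)); exact: long.
Qed.

End Lacunary.

(** * Covering small cubes, then annuli *)

Definition level L n N (w : {ffun 'I_d -> 'I_N.*2.+1}) : nat :=
  n + enum_rank [ffun i => inord (w i %% L.+1) : 'I_L.+1].

(** The free bound A allows the points of a new cube to be placed beyond all earlier ones. The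
    radius is small enough for the ratio rho between levels to outweigh the relative width of the
    cube. *)
Lemma cover_cube (mu : R^nat) rho C delta r A L c :
  1 < rho -> (forall n, 0 < mu n) -> (forall n, rho * mu n <= mu n.+1) ->
  0 < C -> 0 < delta -> 0 < r -> 2 * C <= delta * L.+1%:R ->
  (forall Z, exists n, Z <= mu n /\
     mu (n + #|{ffun 'I_d -> 'I_L.+1}|) <= 2 * mu n) ->
  r <= `|c| ->
  exists s : seq 'rV[R]_d, [/\
    forall p, p \in s -> A <= `|p|,
    forall p q, p \in s -> q \in s -> p != q -> C <= `|p - q| &
    forall a, `|a - c| <= (rho - 1) * r / (4 * (rho + 1)) ->
      exists n p, p \in s /\ `|mu n *: a - p| <= delta].
Proof.
move=> rho1 mu0 muS C0 delta0 r0 CL window rc.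
set eps := (rho - 1) * r / _.
have rho10 : 0 < rho - 1 by rewrite subr_gt0.
have eps0 : 0 < eps by rewrite divr_gt0 ?mulr_gt0//; lra.
have epsE : eps * (4 * (rho + 1)) = (rho - 1) * r.
  by rewrite /eps divfK// gt_eqF// mulr_gt0//; lra.
clearbody eps.
have epsr : 4 * eps <= r.
  have : 0 < rho * eps by rewrite mulr_gt0//; lra.
  nra.
(* The three bounds serve, in order, for h <= eps, for points of norm at least A, and for
   C-separation between levels. *)
pose Z := Num.max (delta / (2 * eps)) (Num.max (2 * A / r)
  (2 * C / ((rho - 1) * r))).
have [n [Zn nM]] := window Z; set m := mu n in Zn nM.
have mE : m = mu n by [].
have m0 : 0 < m by exact: mu0.
clearbody m.
have m_eps : delta <= m * (2 * eps).
  rewrite -ler_pdivrMr ?mulr_gt0//.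
  by apply: le_trans Zn; rewrite /Z !le_max lexx.
have m_A : 2 * A <= m * r.
  rewrite -ler_pdivrMr ?mulr_gt0//.
  by apply: le_trans Zn; rewrite /Z !le_max lexx !orbT.
have m_C : 2 * C <= m * ((rho - 1) * r).
  rewrite -ler_pdivrMr ?mulr_gt0//.
  by apply: le_trans Zn; rewrite /Z !le_max lexx !orbT.
(* All scaling factors used are at most 2m, so a grid error h becomes at most delta. *)
pose h : R := delta / (2 * m).
have hE : h * (2 * m) = delta by rewrite divfK// gt_eqF// mulr_gt0.
have h0 : 0 < h by rewrite divr_gt0// mulr_gt0.
have h_eps : h <= eps by rewrite ler_pdivrMr ?mulr_gt0//; lra.
clearbody h.
pose N := (Num.truncn ((`|c| + eps) / h)).+1.
have hN : `|c| + eps <= h * N%:R.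
  by rewrite mulrC -ler_pdivrMr// ltW// truncnS_gt.
pose lev := @level L n N; pose point w := mu (lev w) *: @grid h N w.
have lev_ge w : m <= mu (lev w).
  by rewrite mE; apply: (lacunary_le rho1 mu0 muS); exact: leq_addr.
have lev_le w : mu (lev w) <= 2 * m.
  apply: le_trans nM; apply: (lacunary_le rho1 mu0 muS).
  by rewrite leq_add2l ltnW.
(* Coordinate [i] attains the sup norm of c; it alone yields the norm bound and the separation
   between levels. *)
have [i ci] := rV_norm_coord (lt_le_trans r0 rc).
have coord w : `|grid h w - c| <= 2 * eps ->
    `|c| - 2 * eps <= `|@grid h N w 0 i| <= `|c| + 2 * eps.
  move=> /(le_trans (rV_coord_le _ i)); rewrite !mxE ci => wc.
  have := ler_distD 0 (h * ((w i)%:R - N%:R)) (c 0 i).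
  have := ler_dist_dist (h * ((w i)%:R - N%:R)) (c 0 i).
  by rewrite ler_norml => /andP[? ?] _; apply/andP; split; lra.
(* The gap is at least mu_(lev w) times (rho - 1)|c| - 2(rho + 1) eps, whose last term is (rho - 1)
   r / 2 by the choice of eps. *)
have far w w' : (lev w < lev w')%N ->
    `|grid h w - c| <= 2 * eps -> `|grid h w' - c| <= 2 * eps ->
    C <= `|point w' - point w|.
  move=> /(lacunary_lt rho1 mu0 muS) ll /coord/andP[_ w2] /coord/andP[w1' _].
  apply: le_trans (rV_coord_le _ i); have -> : (point w' - point w) 0 i =
      mu (lev w') * grid h w' 0 i - mu (lev w) * grid h w 0 i by rewrite !mxE.
  apply: le_trans (lerB_dist _ _); rewrite !normrM !(gtr0_norm (mu0 _)).
  set x := `|grid h w 0 i| in w2 *; set x' := `|grid h w' 0 i| in w1' *.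
  have lw := lev_ge w; have lw0 := mu0 (lev w).
  have e1 : mu (lev w') * (`|c| - 2 * eps) <= mu (lev w') * x'.
    by rewrite ler_wpM2l// ltW.
  have e2 : mu (lev w) * x <= mu (lev w) * (`|c| + 2 * eps).
    by rewrite ler_wpM2l// ltW.
  have e3 : rho * mu (lev w) * (`|c| - 2 * eps) <=
      mu (lev w') * (`|c| - 2 * eps).
    by rewrite ler_wpM2r//; lra.
  have e4 : m * ((rho - 1) * r / 2) <= mu (lev w) * ((rho - 1) * r / 2).
    by rewrite ler_wpM2r// divr_ge0// ltW// mulr_gt0.
  have e5 : mu (lev w) * ((rho - 1) * r) <= mu (lev w) * ((rho - 1) * `|c|).
    by rewrite ler_wpM2l ?(ltW lw0)// ler_wpM2l// ltW.
  have e6 : mu (lev w) * (eps * (4 * (rho + 1))) = mu (lev w) * ((rho - 1) * r).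
    by rewrite epsE.
  by lra.
(* Some coordinate of the indices differs by a nonzero multiple of L+1; scaling makes this at least
   m h (L+1) = delta (L+1) / 2 >= C. *)
have same w w' : lev w = lev w' -> w != w' -> C <= `|point w - point w'|.
  move=> ll ww'; have /existsP[j wj] : [exists j, w j != w' j].
    apply: contraR ww' => /existsPn wE.
    by apply/eqP/ffunP => j; have /negPn/eqP := wE j.
  have wL : w j = w' j %[mod L.+1].
    have /addnI/ord_inj/enum_rank_inj/ffunP/(_ j) := ll.
    rewrite !ffunE => /(congr1 val)/=.
    by rewrite !inordK ?ltn_mod.
  have : (L.+1%:R : R) <= `|(w j)%:R - (w' j)%:R|.
    have far_nat (x y : nat) : (x < y)%N -> x = y %[mod L.+1] ->
        (L.+1%:R : R) <= `|x%:R - y%:R|.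
      move=> xy /esym/eqP; rewrite eqn_mod_dvd 1?ltnW// => Lxy.
      rewrite distrC -natrB 1?ltnW// normr_nat ler_nat dvdn_leq//.
      by rewrite subn_gt0.
    have [lt|lt|/val_inj/eqP] := ltngtP (w j) (w' j).
    - exact: far_nat.
    - by rewrite distrC; exact: far_nat.
    - by rewrite (negPf wj).
  move=> Lw; apply: le_trans (rV_coord_le _ j); rewrite !mxE -ll -mulrBr normrM.
  rewrite -mulrBr opprB addrA subrK normrM (gtr0_norm h0).
  rewrite (gtr0_norm (mu0 _)).
  have e1 : m * (h * L.+1%:R) <= mu (lev w) * (h * L.+1%:R).
    by rewrite ler_wpM2r// mulr_ge0// ltW.
  have e2 : mu (lev w) * (h * L.+1%:R) <=
      mu (lev w) * (h * `|(w j)%:R - (w' j)%:R|).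
    by rewrite ler_wpM2l ?(ltW (mu0 _))// ler_wpM2l// ltW.
  have e3 : delta * L.+1%:R = 2 * (m * (h * L.+1%:R)) by rewrite -hE; ring.
  by lra.
(* The margin 2 eps retains the node within h <= eps of any point of the cube of radius eps. *)
exists [seq point w | w <- enum {ffun 'I_d -> 'I_N.*2.+1}
  & `|grid h w - c| <= 2 * eps]; split.
- move=> _ /mapP[w /[!mem_filter]/andP[/coord/andP[wc _] _] ->].
  apply: le_trans (rV_coord_le _ i); rewrite [_ 0 i]mxE normrM gtr0_norm//.
  have e1 : mu (lev w) * (r / 2) <= mu (lev w) * `|grid h w 0 i|.
    by rewrite ler_wpM2l ?(ltW (mu0 _))//; lra.
  have e2 : m * (r / 2) <= mu (lev w) * (r / 2).
    by rewrite ler_wpM2r// divr_ge0// ltW.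
  by lra.
- move=> p q /mapP[w /[!mem_filter]/andP[wc _] ->].
  move=> /mapP[w' /[!mem_filter]/andP[w'c _] ->].
  have [->|ww'] := eqVneq w w'; first by rewrite eqxx.
  have [lt|lt|ll] := ltngtP (lev w) (lev w') => _.
  + by rewrite distrC; exact: far.
  + exact: far.
  + exact: same.
- move=> a ac.
  have aN : `|a| <= h * N%:R.
    by apply: le_trans hN; rewrite -lerBlDl (le_trans (lerB_dist _ _)).
  have [w wa] := grid_approx h0 aN.
  exists (lev w), (point w); split.
    apply/mapP; exists w => //; rewrite mem_filter mem_enum andbT.
    apply: le_trans (ler_distD a _ _) _; rewrite distrC; lra.
  rewrite -scalerBr normrZ gtr0_norm// -hE.
  have e1 : mu (lev w) * `|a - grid h w| <= mu (lev w) * h.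
    by rewrite ler_wpM2l// ltW.
  have e2 : mu (lev w) * h <= 2 * m * h by rewrite ler_wpM2r// ltW.
  by lra.
Qed.
Lemma cover_annulus (lambda : R^nat) C delta r r' :
  property_SG lambda -> (forall n, 0 < lambda n) ->
  0 < C -> 0 < delta -> 0 < r ->
  exists s : seq 'rV[R]_d, [/\
    forall p, p \in s -> C <= `|p|,
    forall p q, p \in s -> q \in s -> p != q -> C <= `|p - q| &
    forall a, r <= `|a| <= r' ->
      exists n p, p \in s /\ `|lambda n *: a - p| <= delta].
Proof.
move=> SG lambda0 C0 delta0 r0.
pose L := Num.truncn (2 * C / delta).
have CL : 2 * C <= delta * L.+1%:R.
  by rewrite (mulrC delta) -ler_pdivrMr// ltW// truncnS_gt.
pose M := #|{ffun 'I_d -> 'I_L.+1}|.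
have M0 : (0 < M)%N by rewrite /M card_ffun !card_ord expn_gt0.
have [|rho [phi /= [rho1 _ muS SGphi]]] := SG M.*2%:R.
  by rewrite ltr0n double_gt0.
pose mu n := lambda (phi n); have mu0 n : 0 < mu n by exact: lambda0.
have window := lacunary_window rho1 mu0 muS M0 SGphi.
have r20 : 0 < r / 2 by rewrite divr_gt0.
have rho10 : 0 < rho - 1 by rewrite subr_gt0.
set cover_c := fun A c =>
  @cover_cube mu rho C delta (r / 2) A L c rho1 mu0 muS C0 delta0 r20 CL window.
set eps := (rho - 1) * (r / 2) / (4 * (rho + 1)) in cover_c *.
have eps0 : 0 < eps by rewrite divr_gt0 ?mulr_gt0//; lra.
have epsr : eps <= r / 2.
  have den0 : 0 < 4 * (rho + 1) by lra.
  by rewrite /eps ler_pdivrMr// mulrC ler_wpM2l ?(ltW r20)//; lra.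
have cubes (cs : seq 'rV[R]_d) : (forall c, c \in cs -> r / 2 <= `|c|) ->
    exists s : seq 'rV[R]_d, [/\ forall p, p \in s -> C <= `|p|,
    forall p q, p \in s -> q \in s -> p != q -> C <= `|p - q| &
    forall c a, c \in cs -> `|a - c| <= eps ->
      exists n p, p \in s /\ `|mu n *: a - p| <= delta].
  elim: cs => [_|c cs IHcs rcs]; first by exists [::]; split.
  have [|s [sC sS sP]] := IHcs.
    by move=> ? ?; apply: rcs; exact: mem_behead.
  (* Any point of norm at least A is at distance at least C from every point of s. *)
  pose A := C + \sum_(p <- s) `|p|.
  have sA p : p \in s -> `|p| + C <= A.
    move=> ps; rewrite addrC lerD2l (big_rem _ ps)/= lerDl.
    by apply: sumr_ge0 => *.
  have CA : C <= A by rewrite lerDl; apply: sumr_ge0 => *.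
  have [//|t [tA tS tP]] := cover_c A c; first exact/rcs/mem_head.
  have apart p q : p \in s -> q \in t -> C <= `|q - p|.
    move=> /sA ps /tA qt; apply: le_trans (lerB_dist _ _); lra.
  exists (t ++ s); split.
  - by move=> p; rewrite mem_cat => /orP[/tA/(le_trans CA)|/sC].
  - move=> p q; rewrite !mem_cat => /orP[pt|ps] /orP[qt|qs] pq.
    + exact: tS.
    + exact: apart.
    + by rewrite distrC; exact: apart.
    + exact: sS.
  - move=> c' a; rewrite inE => /predU1P[->|c'cs] ac.
      have [n [p [pt np]]] := tP _ ac; exists n, p.
      by rewrite mem_cat pt.
    have [n [p [ps np]]] := sP _ _ c'cs ac; exists n, p.
    by rewrite mem_cat ps orbT.
pose N := (Num.truncn (r' / eps)).+1.
have r'N : r' <= eps * N%:R.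
  by rewrite mulrC -ler_pdivrMr// ltW// truncnS_gt.
(* If |a| >= r, a node within eps <= r/2 of a has norm at least r/2, so it survives the filter. *)
have [c|s [sC sS sP]] := cubes [seq c <- [seq grid eps w |
    w <- enum {ffun 'I_d -> 'I_N.*2.+1}] | r / 2 <= `|c|].
  by rewrite mem_filter => /andP[].
exists s; split=> // a /andP[ra ar'].
have [w aw] := grid_approx eps0 (le_trans ar' r'N).
have [|n [p np]] := sP (grid eps w) a _ aw; last by exists (phi n), p.
rewrite mem_filter map_f ?mem_enum// andbT.
by have := lerB_dist a (a - grid eps w); rewrite subKr; lra.
Qed.

End Covering.

(** * Uniform mixing along finite lists, compact annuli *)

Lemma uniform_mixing_seq (R : realType) (K : numFieldType)
  (X : topologicalLmodType K) (d : nat) (T : 'rV[R]_d -> {linear X -> X})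
  (U V : set X) :
  uniform_mixing T -> open U -> U !=set0 -> open V -> V !=set0 ->
  exists2 C : R, 0 < C & forall s : seq 'rV[R]_d,
    (forall p, p \in s -> C <= `|p|) ->
    (forall p q, p \in s -> q \in s -> p != q -> C <= `|p - q|) ->
    exists2 f, U f & forall p, p \in s -> V (T p f).
Proof.
move=> mixT oU U0 oV V0; have [C C0 CP] := mixT U V oU U0 oV V0.
(* Distinct indices must carry separated points, so repetitions are removed. Uniform mixing asks for
   p >= 1, hence the separate empty case. *)
exists C => // s sC sS; pose t := undup s.
have [t0|t_gt0] := posnP (size t).
  have [f Uf] := U0; exists f => // p.
  by rewrite -mem_undup -/t (size0nil t0).
have ts (i : 'I_(size t)) : t`_i \in s by rewrite -mem_undup mem_nth.
have [||f Uf fV] := CP (size t) (fun i => t`_i) t_gt0.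
- by move=> i; apply: le_trans (rV_norm_le_enorm _); exact: sC.
- move=> i j ij; apply: le_trans (rV_norm_le_enorm _); apply: sS => //.
  by rewrite nth_uniq ?undup_uniq.
exists f => // p; rewrite -mem_undup -/t => /(nthP 0)[i it <-].
exact: (fV (Ordinal it)).
Qed.

Lemma annulus_compact (R : realType) d (r r' : R) :
  compact [set a : 'rV[R]_d | r <= `|a| <= r'].
Proof.
apply: bounded_closed_compact.
  exists r'; split=> [|M r'M a /andP[_ ar']]; first exact: num_real.
  exact: le_trans ar' (ltW r'M).
rewrite (_ : mkset _ = (fun a => `|a|) @^-1` `[r, r']%classic).
  by apply: closed_comp => [a _|]; [exact: norm_continuous|exact: itv_closed].
by apply/seteqP; split=> a; rewrite /= in_itv.
Qed.

(** * Openness and density of the hitting sets *)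

Section Orbits.
Context (R : realType) (K : numFieldType) (X : topologicalLmodType K).
Context (dist : X -> X -> R) (distP : complete_invariant_metric dist).
Context (d : nat) (T : 'rV[R]_d -> {linear X -> X}).
Context (groupT : operator_group T) (contT : strongly_continuous T).
Context (lambda : R^nat) (lambda0 : forall n, 0 < lambda n).

Definition hitting (A : set 'rV[R]_d) (V : set X) : set X :=
  [set f | forall a, A a -> exists n, V (T (lambda n *: a) f)].

Lemma open_hitting A V : compact A -> open V -> open (hitting A V).
Proof.
move=> /compact_near_coveringP cA oV; rewrite openE => f fA.
(* The near-covering form of compactness merges the neighbourhoods of f found for each a into one
   valid on all of A. *)
apply: (cA X (nbhs f) (fun g a => exists n, V (T (lambda n *: a) g))) => a Aa.
have [n Vn] := fA a Aa.
have [delta [r [delta0 r0 TV]]] :=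
  operator_group_continuous distP groupT contT (open_nbhs_nbhs (conj oV Vn)).
exists ([set b | `|a - b| < delta / lambda n], [set g | dist f g < r]) => /=.
  split; last by apply/(nbhs_distP distP); exists r.
  rewrite -(@filter_from_norm_nbhs _ 'rV[R]_d).
  by exists (delta / lambda n) => //=; exact: divr_gt0.
move=> [b g] /= [ab fg]; exists n; apply: TV => //.
by rewrite -scalerBr normrZ gtr0_norm// mulrC -ltr_pdivlMr// distrC.
Qed.

Lemma dense_hitting r r' V : uniform_mixing T -> property_SG lambda ->
  0 < r -> open V -> V !=set0 ->
  dense (hitting [set a | r <= `|a| <= r'] V).
Proof.
move=> mixT SG r0 oV [v Vv] U U0 oU.
(* Mixing will aim at a ball around v that every T_b with |b| < delta sends into V; this absorbs the
   covering error. *)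
have [|delta [e [delta0 e0 TV]]] := @operator_group_continuous _ _ _ _ distP _
    _ groupT contT 0 v V.
  by rewrite (opgroup0 groupT); exact: open_nbhs_nbhs.
have [|C C0 mix] := uniform_mixing_seq mixT oU U0 (open_dist distP v e).
  by exists v; rewrite /= (dist_refl distP).
(* Halving makes the non-strict covering bound strict. *)
have delta20 : 0 < delta / 2 by rewrite divr_gt0.
have [s [sC sS cover]] := cover_annulus d r' SG lambda0 C0 delta20 r0.
have [f Uf fV] := mix s sC sS.
exists f; split=> // a /cover[n [p [ps ap]]]; exists n.
rewrite -(subrK p (lambda n *: a)) (opgroupD groupT).
by apply: TV; [rewrite subr0; lra | exact: fV].
Qed.

End Orbits.

Theorem theorem2p8 (R : realType) (k : scalar_kind) (d : nat)
  (X : topologicalLmodType (scalars R k)) (T : 'rV[R]_d -> {linear X -> X})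
  (lambda : R^nat) :
  (1 <= d)%N ->
  F_space R X ->
  separable X ->
  operator_group T ->
  strongly_continuous T ->
  uniform_mixing T ->
  (forall n, 0 < lambda n) ->
  increasing_seq lambda ->
  property_SG lambda ->
  residual (\bigcap_(a in [set a : 'rV[R]_d | a != 0])
    hypercyclic_vectors (fun n => T (lambda n *: a) : X -> X)).
Proof.
move=> _ [dist distP] [D [cD dD]] groupT contT mixT lambda0 _ SG.
have [x [_ Dx]] := dD setT (ex_intro _ 0 I) openT.
have [D0|[u Du]] : D = set0 \/ exists u : nat -> X, D `<=` range u.
  have /pfcard_geP[->|[u]] := cD; first by left.
  by right; exists u => y Dy; have [n _ <-] := 'surj_u Dy; exists n.
  by rewrite D0 in Dx.
pose A m := [set a : 'rV[R]_d | m.+1%:R^-1 <= `|a| <= m.+1%:R].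
pose V q j := [set y | dist (u q) y < j.+1%:R^-1].
(* An integer coding no triple defaults to (0, 0, 0), so every [F i] is still an open dense hitting
   set. *)
pose F i := let: (m, q, j) := odflt (0, 0, 0)%N (unpickle i) in
  hitting T lambda (A m) (V q j).
have inv0 n : (0 : R) < n.+1%:R^-1 by rewrite invr_gt0.
have oF i : open (F i).
  rewrite /F; case: (odflt _ _) => [[m q] j].
  apply: (open_hitting distP groupT contT lambda0 (@annulus_compact _ _ _ _)).
  exact: (open_dist distP).
have dF i : dense (F i).
  rewrite /F; case: (odflt _ _) => [[m q] j].
  apply: (dense_hitting distP groupT contT lambda0) => //.
    exact: (open_dist distP).
  by exists (u q); rewrite /V /= (dist_refl distP).
exists (\bigcap_i F i); split; first by exists F.
  exact: (F_space_Baire distP).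
move=> f fF a /= a0 W [w Ww] oW.
have /(nbhs_distP distP)[e e0 eW] := open_nbhs_nbhs (conj oW Ww).
have [j je] : exists j, (j.+1%:R^-1 : R) < e / 2.
  exists (Num.truncn (e / 2)^-1).
  by rewrite -ltf_pV2 ?posrE ?invr_gt0 ?divr_gt0// invrK truncnS_gt.
have [y [/= wy Dy]] : [set y | dist w y < j.+1%:R^-1] `&` D !=set0.
  apply: dD; last exact: (open_dist distP).
  by exists w; rewrite /= (dist_refl distP).
have [q _ qy] := Du _ Dy.
have na0 : 0 < `|a| by rewrite normr_gt0.
(* Both |a| and its inverse are then below m + 1. *)
pose m := maxn (Num.truncn `|a|) (Num.truncn `|a|^-1).
have Am : A m a.
  apply/andP; split; last first.
    by rewrite (le_trans (ltW (truncnS_gt _)))// ler_nat ltnS leq_maxl.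
  rewrite -lef_pV2 ?posrE ?invr_gt0// invrK.
  by rewrite (le_trans (ltW (truncnS_gt _)))// ler_nat ltnS leq_maxr.
have := fF (pickle (m, q, j)) I; rewrite /F pickleK /= => /(_ a Am)[n].
rewrite /V /= qy => yn; exists (T (lambda n *: a) f); split; last by exists n.
apply: eW; have := lt_trans yn je; have := lt_trans wy je.
by have := dist_triangle distP y w (T (lambda n *: a) f); lra.
Qed.
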